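(* Let $A:D(A)\subseteq\mathcal H\to\mathcal H$ be a self-adjoint operator on the Hilbert space $\mathcal H$, let $\mathfrak h$ be a Hilbert space, let $\tau:\mathcal H_+\to\mathfrak h$ be a bounded linear surjective map whose kernel is dense in $\mathcal H$, and let $\Theta:D(\Theta)\subseteq\mathfrak h\to\mathfrak h$ be a (possibly unbounded) self-adjoint operator. Let $\hat A$ be the singular perturbation of $A$ given by $$D(\hat A)=\{\phi\in\mathcal H:\ \phi=\phi_*+G_*\zeta_\phi,\ \phi_*\in D(A),\ \zeta_\phi\in D(\Theta),\ \Theta\,\zeta_\phi=\tau\phi_*\},\qquad \hat A\phi=A\phi_*+RG\,\zeta_\phi,$$ and let $\Gamma(z):=\tau(G_*-G(z))$ for $z\in\rho(A)$, where $R,G,G_*,G(z)$ are as defined in the context. Then for any $\lambda\in\sigma_p(\hat A)\cap\rho(A)$ the map $$\zeta\mapsto G(\lambda)\,\zeta$$ is a bijection from $\mathrm{Ker}(\Theta+\Gamma(\lambda))$ onto $\mathrm{Ker}(-\hat A+\lambda)$.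
   Context: Hilbert spaces are complex, and $\langle\cdot,\cdot\rangle$ is the inner product of $\mathcal H$. A self-adjoint operator $\hat A$ on $\mathcal H$ is a singular perturbation of $A$ if the set $\{\phi\in D(\hat A)\cap D(A):\hat A\phi=A\phi\}$ is dense in $\mathcal H$. $\mathcal H_+$ denotes the Hilbert space given by the set $D(A)$ with inner product $\langle\phi_1,\phi_2\rangle_+:=\langle A\phi_1,A\phi_2\rangle+\langle\phi_1,\phi_2\rangle$; $\rho(\cdot)$ denotes the resolvent set and $\sigma_p(\cdot)$ the point spectrum (set of eigenvalues). For $z\in\rho(A)$ define $$R(z):=(-A+z)^{-1}:\mathcal H\to\mathcal H_+,\qquad G(z):=(\tau R(\bar z))^*:\mathfrak h\to\mathcal H$$ (the adjoint of the bounded operator $\tau R(\bar z):\mathcal H\to\mathfrak h$), and $$R:=R(i),\qquad G:=G(-i),\qquad G_*:=\tfrac12\,(G(i)+G(-i)).$$ In this setting $D(A)\cap\mathrm{Ran}(G_* )=\{0\}$ and $G_*$ is injective, so that $\phi_*$ and $\zeta_\phi$ in the decomposition $\phi=\phi_*+G_*\zeta_\phi$ are uniquely determined by $\phi$; moreover $\mathrm{Ran}(G_*-G(z))\subseteq D(A)$, so that $\Gamma(z)=\tau(G_*-G(z))\in\mathsf B(\mathfrak h)$ (bounded operators on $\mathfrak h$) is defined. The operator $\Theta+\Gamma(\lambda)$ has domain $D(\Theta)$. *)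

(* Defs.v *)
From HB Require Import structures.
From mathcomp Require Import all_boot all_order all_algebra sesquilinear complex.
From mathcomp Require Import all_classical all_reals topology normedtype.

Set Implicit Arguments.
Unset Strict Implicit.
Unset Printing Implicit Defensive.

Import Order.TTheory GRing.Theory Num.Theory.
Import numFieldNormedType.Exports.

Local Open Scope classical_set_scope.
Local Open Scope ring_scope.

(* The inner product is linear in its first argument and conjugate-linear in
   its second one; it induces the norm, for which the space is complete. *)
HB.mixin Record CompleteNormedModule_isHilbert (R : realType) H
    of CompleteNormedModule R[i] H := {
  inner : {dot H for (@Num.conj R[i])} ;
  innerE : forall x : H, inner x x = `|x| ^+ 2
}.

#[short(type="hilbertType")]
HB.structure Definition Hilbert (R : realType) :=
  {H of CompleteNormedModule_isHilbert R H & CompleteNormedModule R[i] H}.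

(* A possibly unbounded operator; only the values on [dom] are meaningful. *)
Record operator (H K : Type) := Operator {
  dom : set H ;
  opfun :> H -> K
}.

Section Operators.
Variable R : realType.
Implicit Types H K h : hilbertType R.

Definition linear_operator H K (T : operator H K) : Prop :=
  dom T 0 /\
  forall (a : R[i]) x y, dom T x -> dom T y ->
    dom T (a *: x + y) /\ T (a *: x + y) = a *: T x + T y.

Definition bounded_map H K (f : H -> K) : Prop :=
  exists C : R, forall x, `|f x| <= (C%:C)%C * `|x|.

Definition everywhere H K (f : H -> K) : operator H K := Operator setT f.

Definition adjoint_rel H K (T : operator H K) (y : K) : set H :=
  [set y' | forall x, dom T x -> inner (T x) y = inner x y'].

(* For a densely defined T the vector picked by [get] is the only one. *)
Definition adjoint H K (T : operator H K) : operator K H :=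
  Operator [set y | exists y', adjoint_rel T y y'] (fun y => get (adjoint_rel T y)).

Definition self_adjoint H (T : operator H H) : Prop :=
  [/\ linear_operator T, dense (dom T), dom (adjoint T) = dom T &
      forall x, dom T x -> adjoint T x = T x].

Definition ker H K (T : operator H K) : set H :=
  [set x | dom T x /\ T x = 0].

Definition addop H K (T : operator H K) (B : H -> K) : operator H K :=
  Operator (dom T) (fun x => T x + B x).

Definition zsubop H (T : operator H H) (z : R[i]) : operator H H :=
  Operator (dom T) (fun x => - T x + z *: x).

(* (- T + z)^-1, with values in dom T when z is in the resolvent set *)
Definition resolvent H (T : operator H H) (z : R[i]) : H -> H :=
  'pinv_(fun=> 0) (dom T) (zsubop T z).

Definition resolvent_set H (T : operator H H) : set R[i] :=
  [set z | set_bij (dom T) setT (zsubop T z) /\ bounded_map (resolvent T z)].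

Definition point_spectrum H (T : operator H H) : set R[i] :=
  [set z | exists x, [/\ dom T x, x != 0 & T x = z *: x]].

(* The space H_+ is the set dom A with this inner product. *)
Definition inner_plus H (A : operator H H) (x y : H) : R[i] :=
  inner (A x) (A y) + inner x y.

Definition norm_plus H (A : operator H H) (x : H) : R[i] :=
  sqrtC (inner_plus A x x).

(* tau is a bounded linear map from H_+ onto h. *)
Definition bounded_linear_surjection H h (A : operator H H)
    (tau : operator H h) : Prop :=
  [/\ dom tau = dom A, linear_operator tau,
      exists C : R, forall x, dom A x -> `|tau x| <= (C%:C)%C * norm_plus A x &
      set_surj (dom A) setT tau].

End Operators.

Section SingularPerturbation.
Variables (R : realType) (H h : hilbertType R).
Variables (A : operator H H) (tau : operator H h) (Theta : operator h h).

Definition Gz (z : R[i]) : h -> H :=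
  adjoint (everywhere (tau \o resolvent A z^*)).

Definition Gstar : h -> H := fun xi => 2^-1 *: (Gz 'i xi + Gz (- 'i) xi).

Definition Gamma (z : R[i]) : h -> h := fun xi => tau (Gstar xi - Gz z xi).

Definition Ahat_decomposition (phi : H) : set (H * h) :=
  [set p | [/\ phi = p.1 + Gstar p.2, dom A p.1, dom Theta p.2 &
               Theta p.2 = tau p.1]].

(* The pair (phi_*, zeta_phi) picked by [get] is the only decomposition of
   phi, since dom A meets the range of Gstar trivially and Gstar is
   injective. *)
Definition Ahat : operator H H :=
  Operator [set phi | exists p, Ahat_decomposition phi p]
    (fun phi => let p := get (Ahat_decomposition phi) in
                A p.1 + resolvent A 'i (Gz (- 'i) p.2)).

End SingularPerturbation.

(* Main.v *)
(* For p in D(A) and zeta in D(Theta) such that phi = p + G_* zeta belongs to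
   D(Ahat), one has (-Ahat + z) phi = (-A + z) (phi - G(z) zeta) for z in rho(A):
   this follows from the first resolvent identity
     G(z) - G(w) = (w - z) R(w) G(z),
   which gives G_* = G - i R G and (-A + z) (G_* - G(z)) = z G_* - R G.
   As -A + lambda is injective, phi is in the kernel of -Ahat + lambda iff
   phi = G(lambda) zeta, i.e. p = - (G_* - G(lambda)) zeta, and then the boundary
   condition Theta zeta = tau p says that zeta is in the kernel of
   Theta + Gamma(lambda).  The existence of G(z) is the Riesz representation
   theorem, and +i, -i are in rho(A) by self-adjointness. *)
Require Import Defs.
From mathcomp Require Import all_boot all_order all_algebra complex.
From mathcomp Require Import sesquilinear ring lra.
From mathcomp Require Import all_classical all_reals topology normedtype.

Set Implicit Arguments.
Unset Strict Implicit.
Unset Printing Implicit Defensive.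

Import Order.TTheory GRing.Theory Num.Theory.
Import numFieldNormedType.Exports.

Local Open Scope classical_set_scope.
Local Open Scope ring_scope.

(** * Hilbert spaces: real-valued norm, projection, Riesz representation *)

(** The norm of a complex space takes values in [R[i]]. Its real part lies in [R], where infima and
    [lra] apply. *)
Definition rnorm (R : realType) (V : normedZmodType R[i]) (x : V) : R := complex.Re `|x|.

Section RealNorm.
Variables (R : realType) (V : normedZmodType R[i]).
Implicit Types (x y : V).

Lemma rnormE x : (rnorm x)%:C%C = `|x|.
Proof. by have := normr_ge0 x; rewrite /rnorm; case: `|x| => u v /= /andP[/eqP->]. Qed.

Lemma rnorm_ge0 x : 0 <= rnorm x.
Proof. by rewrite -lecR rnormE normr_ge0. Qed.

Lemma rnorm0_eq0 x : rnorm x = 0 -> x = 0.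
Proof. by move=> x0; apply/eqP; rewrite -normr_eq0 -rnormE x0. Qed.

Lemma rnormN x : rnorm (- x) = rnorm x.
Proof. by rewrite /rnorm normrN. Qed.

Lemma rnorm_distC x y : rnorm (x - y) = rnorm (y - x).
Proof. by rewrite /rnorm distrC. Qed.

Lemma ler_rnormD x y : rnorm (x + y) <= rnorm x + rnorm y.
Proof. by rewrite -lecR rmorphD /= !rnormE ler_normD. Qed.

Lemma rnorm_small0 x : (forall e : R, 0 < e -> rnorm x <= e) -> x = 0.
Proof.
move=> small; apply/rnorm0_eq0/eqP; rewrite eq_le rnorm_ge0 andbT.
by apply/ler_addgt0Pl => e e0; rewrite addr0 small.
Qed.

End RealNorm.

Lemma rnormZ (R : realType) (V : normedModType R[i]) (a : R[i]) (x : V) :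
  rnorm (a *: x) = rnorm a * rnorm x.
Proof. by apply: (@complexI R); rewrite rmorphM /= !rnormE normrZ. Qed.

Lemma rnorm2C (R : realType) (a : R[i]) : ((rnorm a) ^+ 2)%:C%C = a * a^*.
Proof. by rewrite rmorphXn /= rnormE normCK. Qed.

(** * Sesquilinearity and the Cauchy-Schwarz inequality *)

Section InnerProduct.
Variables (R : realType) (H : hilbertType R).
Implicit Types (x y z : H) (a : R[i]).

Lemma innerDl x y z : inner (x + y) z = inner x z + inner y z.
Proof. exact: linearDl. Qed.

Lemma innerDr x y z : inner z (x + y) = inner z x + inner z y.
Proof. exact: linearD. Qed.

Lemma innerZl a x z : inner (a *: x) z = a * inner x z.
Proof. exact: linearZl_LR. Qed.

Lemma innerZr a x z : inner z (a *: x) = a^* * inner z x.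
Proof. exact: linearZ. Qed.

Lemma innerC x z : inner z x = (inner x z)^*.
Proof. by rewrite (hermC inner) expr0 mul1r. Qed.

Lemma innerNl x z : inner (- x) z = - inner x z.
Proof. by rewrite -scaleN1r innerZl mulN1r. Qed.

Lemma innerNr x z : inner z (- x) = - inner z x.
Proof. by rewrite -scaleN1r innerZr rmorphN1 mulN1r. Qed.

Lemma innerBl x y z : inner (x - y) z = inner x z - inner y z.
Proof. by rewrite innerDl innerNl. Qed.

Lemma innerBr x y z : inner z (x - y) = inner z x - inner z y.
Proof. by rewrite innerDr innerNr. Qed.

Lemma inner0l x : inner 0 x = 0.
Proof. by rewrite -(scale0r 0) innerZl mul0r. Qed.

Lemma inner0r x : inner x 0 = 0.
Proof. by rewrite innerC inner0l rmorph0. Qed.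

Lemma inner_eq0 x : inner x x = 0 -> x = 0.
Proof. by rewrite innerE => /eqP; rewrite expf_eq0 normr_eq0 => /eqP. Qed.

Lemma inner_rnorm x : inner x x = (rnorm x ^+ 2)%:C%C.
Proof. by rewrite innerE rmorphXn /= rnormE. Qed.

Lemma eq_inner x y : (forall z, inner z x = inner z y) -> x = y.
Proof.
by move=> xy; apply/eqP; rewrite -subr_eq0; apply/eqP/inner_eq0; rewrite innerBr xy subrr.
Qed.

Lemma eq_innerl x y : (forall z, inner x z = inner y z) -> x = y.
Proof. by move=> xy; apply: eq_inner => z; rewrite innerC xy -innerC. Qed.

Lemma rnorm_parallelogram x y :
  rnorm (x + y) ^+ 2 + rnorm (x - y) ^+ 2 = 2 * rnorm x ^+ 2 + 2 * rnorm y ^+ 2.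
Proof.
apply: (@complexI R); rewrite !mulr_natl !(rmorphD, rmorphMn) /= -!inner_rnorm.
rewrite !(innerBl, innerBr, innerDl, innerDr).
ring.
Qed.

(** The parameter [e] stays free: [rnorm y ^- 2] gives Cauchy-Schwarz, and a smaller value serves
    the projection theorem without dividing by [rnorm y]. *)
Lemma rnorm_sub_proj x y (e : R) :
  rnorm (x - (e%:C%C * inner x y) *: y) ^+ 2 =
  rnorm x ^+ 2 - 2 * e * rnorm (inner x y) ^+ 2
  + e ^+ 2 * rnorm (inner x y) ^+ 2 * rnorm y ^+ 2.
Proof.
have eC : (e%:C%C)^* = e%:C%C :> R[i] by apply/CrealP; rewrite complex_real.
have expand : inner (x - (e%:C%C * inner x y) *: y) (x - (e%:C%C * inner x y) *: y) =
    inner x x - 2 * e%:C%C * (inner x y * (inner x y)^*)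
    + e%:C%C * e%:C%C * (inner x y * (inner x y)^*) * inner y y.
  by rewrite !(innerBl, innerBr, innerZl, innerZr) (innerC x y) rmorphM /= eC; ring.
apply: (@complexI R); rewrite -inner_rnorm expand !inner_rnorm -rnorm2C.
by rewrite [e ^+ 2]expr2 !(rmorphD, rmorphN, rmorphM, rmorph_nat).
Qed.

Lemma CauchySchwarz_rnorm x y : rnorm (inner x y) <= rnorm x * rnorm y.
Proof.
have [y0|yn0] := eqVneq (rnorm y) 0.
  rewrite (rnorm0_eq0 y0) inner0r /rnorm !normr0 /= mulr0 //.
have y_gt0 : 0 < rnorm y by rewrite lt_neqAle eq_sym yn0 rnorm_ge0.
rewrite -(@ler_pXn2r _ 2) ?nnegrE ?mulr_ge0 ?rnorm_ge0// exprMn.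
(* This is the vector from [x] to its projection on the line of [y]; that its squared length is
   nonnegative is the inequality sought. *)
have := sqr_ge0 (rnorm (x - ((rnorm y ^- 2)%:C%C * inner x y) *: y)).
rewrite rnorm_sub_proj.
have -> : rnorm x ^+ 2 - 2 * rnorm y ^- 2 * rnorm (inner x y) ^+ 2 +
  rnorm y ^- 2 ^+ 2 * rnorm (inner x y) ^+ 2 * rnorm y ^+ 2 =
  rnorm x ^+ 2 - rnorm (inner x y) ^+ 2 / rnorm y ^+ 2 by field.
by rewrite subr_ge0 ler_pdivrMr ?exprn_gt0.
Qed.

End InnerProduct.

(** * Sequential completeness, limits of inner products and density *)

Section Completeness.
Variables (R : realType) (H : hilbertType R).
Implicit Types (u v : nat -> H) (x y l : H) (S : set H).

Definition rnorm_cvg u l := forall e : R, 0 < e ->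
  exists N, forall n, (N <= n)%N -> rnorm (u n - l) < e.

Definition rnorm_cauchy u := forall e : R, 0 < e ->
  exists N, forall n m, (N <= n)%N -> (N <= m)%N -> rnorm (u n - u m) < e.

Lemma rnorm_complete u : rnorm_cauchy u -> exists l, rnorm_cvg u l.
Proof.
move=> uC.
(* A positive element of [R[i]] is real, so real radii suffice for the Cauchy criterion. *)
have gt0C (e : R[i]) : 0 < e -> exists2 r : R, e = r%:C%C & 0 < r.
  by case: e => a b /andP[/eqP/= -> a0]; exists a.
have : cvg (u @ \oo).
  apply: cauchy_cvg; apply: cauchy_exP => _ /gt0C[e -> e0].
  have [N HN] := uC e e0; exists (u N).
  by exists N => // n /= Nn; rewrite -ball_normE /ball_ /= -rnormE ltcR; exact: HN.
move=> /cvg_ex[l ul]; exists l => e e0.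
have ec0 : 0 < e%:C%C :> R[i] by rewrite ltcR.
have /cvgrPdist_lt/(_ _ ec0)[N _ HN] := ul.
exists N => n Nn; rewrite rnorm_distC -ltcR rnormE.
exact: HN.
Qed.

Lemma rnorm_cvg_cauchy u l : rnorm_cvg u l -> rnorm_cauchy u.
Proof.
move=> ul e e0; have e20 : 0 < e / 2 by rewrite divr_gt0.
have [N HN] := ul _ e20; exists N => n m Nn Nm.
have := ler_rnormD (u n - l) (l - u m); rewrite addrA subrK.
by have := HN _ Nn; have := HN _ Nm; rewrite (rnorm_distC (u m)); lra.
Qed.

(** Continuity of the inner product, in the form that carries an adjoint relation over to limits. *)
Lemma inner_cvgl u v x y k l : rnorm_cvg u k -> rnorm_cvg v l ->
  (forall n, inner x (u n) = inner y (v n)) -> inner x k = inner y l.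
Proof.
move=> uk vl xy; apply/eqP; rewrite -subr_eq0; apply/eqP/rnorm_small0 => e e0.
(* The summand 1 keeps [b] positive when [x] and [y] both vanish. *)
pose b := rnorm x + rnorm y + 1.
have b0 : 0 < b by rewrite ltr_wpDl// addr_ge0 ?rnorm_ge0.
have eb0 : 0 < e / b by rewrite divr_gt0.
have [N HN] := uk _ eb0; have [M HM] := vl _ eb0.
have {HN} := HN (maxn N M) (leq_maxl _ _).
have {HM} := HM (maxn N M) (leq_maxr _ _).
set n := maxn N M => vn un.
have -> : inner x k - inner y l = inner y (v n - l) + - inner x (u n - k).
  by rewrite !innerBr xy; ring.
apply: (le_trans (ler_rnormD _ _)); rewrite rnormN.
have h1 := CauchySchwarz_rnorm y (v n - l).
have h2 := CauchySchwarz_rnorm x (u n - k).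
have -> : e = b * (e / b) by rewrite mulrCA divff ?mulr1 ?gt_eqF.
have h3 : rnorm y * rnorm (v n - l) <= rnorm y * (e / b).
  by rewrite ler_wpM2l ?rnorm_ge0 ?ltW.
have h4 : rnorm x * rnorm (u n - k) <= rnorm x * (e / b).
  by rewrite ler_wpM2l ?rnorm_ge0 ?ltW.
rewrite /b; lra.
Qed.

Lemma dense_rnorm S x (e : R) : dense S -> 0 < e -> exists2 s, S s & rnorm (x - s) < e.
Proof.
move=> dS e0; have ec0 : 0 < e%:C%C :> R[i] by rewrite ltcR.
have [||s [xs Ss]] := dS (ball x e%:C%C).
- by exists x; exact: ballxx.
- exact: ball_open.
exists s => //; move: xs; rewrite -ball_normE /ball_ /= => xs.
by rewrite -ltcR rnormE.
Qed.

(** For [s] in [S], [inner x x = inner (x - s) x], which is at most [rnorm (x - s) * rnorm x];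
    density makes the first factor arbitrarily small. *)
Lemma dense_orth S x : dense S -> (forall s, S s -> inner s x = 0) -> x = 0.
Proof.
move=> dS xS; apply: rnorm_small0 => e e0.
have [s Ss xs] := dense_rnorm x dS e0.
have [x0|xn0] := eqVneq (rnorm x) 0; first by rewrite x0 ltW.
have x_gt0 : 0 < rnorm x by rewrite lt_neqAle eq_sym xn0 rnorm_ge0.
rewrite -(ler_pM2r x_gt0) -expr2.
have -> : rnorm x ^+ 2 = rnorm (inner (x - s) x).
  rewrite innerBl (xS s)// subr0 inner_rnorm /rnorm ger0_norm //.
  by rewrite lecR sqr_ge0.
by apply: (le_trans (CauchySchwarz_rnorm _ _)); rewrite ler_pM2r// ltW.
Qed.

(** * Closed subspaces: orthogonal projection and Riesz representation *)

Definition subspace S := S 0 /\ forall a x y, S x -> S y -> S (a *: x + y).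

Definition seq_closed S := forall u l, (forall n, S (u n)) -> rnorm_cvg u l -> S l.

Lemma subspaceD S x y : subspace S -> S x -> S y -> S (x + y).
Proof. by move=> [_ SP] Sx Sy; rewrite -[x]scale1r; exact: SP. Qed.

Lemma subspaceZ S a x : subspace S -> S x -> S (a *: x).
Proof. by move=> [S0 SP] Sx; rewrite -[_ *: _]addr0; exact: SP. Qed.

(* A minimizing sequence for the distance from y to S is Cauchy by the
   parallelogram identity. *)
Lemma orthogonal_projection S y : subspace S -> seq_closed S ->
  exists2 s, S s & forall t, S t -> inner (y - s) t = 0.
Proof.
move=> Ssub Scl; pose E := [set rnorm (y - t) ^+ 2 | t in S].
have E0 : E !=set0 by exists (rnorm (y - 0) ^+ 2), 0 => //; exact: Ssub.1.
have Elb : has_lbound E by exists 0 => _ [t _ <-]; exact: sqr_ge0.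
pose d := inf E.
have dle t : S t -> d <= rnorm (y - t) ^+ 2 by move=> St; apply: ge_inf => //; exists t.
have /choice[u Hu] n : exists t, S t /\ rnorm (y - t) ^+ 2 < d + n.+1%:R^-1.
  have n0 : 0 < n.+1%:R^-1 :> R by rewrite invr_gt0.
  by have [_ [t St <-] lt] := inf_adherent n0 (conj E0 Elb); exists t.
have small (e : R) : 0 < e -> exists N, forall n, (N <= n)%N -> n.+1%:R^-1 < e.
  move=> e0; have [N] := ltr_add_invr e0; rewrite add0r => HN; exists N => n Nn.
  by apply: le_lt_trans HN; rewrite lef_pV2 ?posrE// ler_nat ltnS.
have uC : rnorm_cauchy u.
  move=> e e0.
  (* The midpoint of [u n] and [u m] lies in [S], so the terms in [d] cancel and
     [rnorm (u n - u m) ^+ 2] is less than 2/(n+1) + 2/(m+1), hence than [e ^+ 2]. *)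
  have [|N HN] := small (e ^+ 2 / 4); first by rewrite divr_gt0 ?exprn_gt0.
  exists N => n m Nn Nm.
  have [Sn un] := Hu n; have [Sm um] := Hu m.
  have Smid : S (2^-1 *: (u n + u m)) by apply: subspaceZ => //; exact: subspaceD.
  have := rnorm_parallelogram (y - u n) (y - u m).
  have -> : y - u n + (y - u m) = 2 *: (y - 2^-1 *: (u n + u m)).
    by rewrite scalerBr scalerA divff ?pnatr_eq0// scale1r scaler_nat mulr2n opprD addrACA.
  have -> : y - u n - (y - u m) = u m - u n.
    by rewrite opprB addrC addrA subrK.
  rewrite rnormZ exprMn (_ : rnorm 2 = 2); last first.
    by rewrite /rnorm (_ : 2 = 2%:R%:C%C) ?rmorph_nat// ger0_norm ?lecR.
  rewrite (rnorm_distC (u m)) => par.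
  have h1 := dle _ Smid; have h2 := HN _ Nn; have h3 := HN _ Nm.
  rewrite -(@ltr_pXn2r _ 2) ?nnegrE ?rnorm_ge0 ?ltW//.
  move: n.+1%:R^-1 m.+1%:R^-1 un um h2 h3 => p q; lra.
have [s us] := rnorm_complete uC.
have Ss : S s by apply: Scl us => n; exact: (Hu n).1.
exists s => // t St; apply: rnorm_small0 => e e0.
(* Orthogonality: moving [u n] along [t] by [T^-1 * c] cannot bring the squared distance below [d].
   As [T] dominates [rnorm t ^+ 2], this forces [rnorm c ^+ 2 / T] below 1/(n+1). The summand 1
   makes [T] positive and a bound for [rnorm t] as well. *)
pose T := rnorm t ^+ 2 + 1; have T0 : 0 < T by rewrite ltr_wpDl ?sqr_ge0.
have Ti0 : 0 < T^-1 by rewrite invr_gt0.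
have e20 : 0 < e / 2 by rewrite divr_gt0.
have [|N HN] := small ((e / 2) ^+ 2 / T); first by rewrite divr_gt0 ?exprn_gt0.
have [M HM] := us _ (divr_gt0 e20 T0).
pose n := maxn N M; have := HN n (leq_maxl _ _); have := HM n (leq_maxr _ _).
have [Sn un] := Hu n => usn Tn.
set c := inner (y - u n) t.
have : d <= rnorm (y - u n - (T^-1%:C%C * c) *: t) ^+ 2.
  by rewrite -addrA -opprD; apply: dle; apply: subspaceD => //; exact: subspaceZ.
rewrite rnorm_sub_proj -/c => min.
have c_le : rnorm c <= e / 2.
  rewrite -(@ler_pXn2r _ 2) ?nnegrE ?rnorm_ge0 ?(ltW e20)// -(ler_pM2l Ti0).
  have tT : T^-1 ^+ 2 * rnorm c ^+ 2 * rnorm t ^+ 2 <= T^-1 * rnorm c ^+ 2.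
    have -> : T^-1 ^+ 2 * rnorm c ^+ 2 * rnorm t ^+ 2
              = T^-1 * rnorm c ^+ 2 * (rnorm t ^+ 2 / T) by ring.
    rewrite ler_piMr ?mulr_ge0 ?sqr_ge0 ?invr_ge0 ?rnorm_ge0 ?(ltW T0)// ler_pdivrMr// mul1r.
    by rewrite /T lerDl.
  have {}Tn : n.+1%:R^-1 < T^-1 * (e / 2) ^+ 2 by rewrite mulrC.
  move: un Tn min tT; move: n.+1%:R^-1 T^-1 (e / 2) => q p r; lra.
have -> : inner (y - s) t = c + inner (u n - s) t.
  by rewrite /c -innerDl addrA subrK.
apply: (le_trans (ler_rnormD _ _)).
have h := CauchySchwarz_rnorm (u n - s) t.
have tT : rnorm t <= T by rewrite /T; have := sqr_ge0 (rnorm t - 1); have := rnorm_ge0 t; nra.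
have usT : rnorm (u n - s) * T < e / 2 by rewrite -ltr_pdivlMr.
have : rnorm (u n - s) * rnorm t <= rnorm (u n - s) * T by rewrite ler_wpM2l ?rnorm_ge0.
by move: c_le h usT; lra.
Qed.

(** Take [y] outside the kernel of [f] and let [r] be [y] minus its projection on the kernel. Then
    [f r *: x - f x *: r] lies in the kernel, hence is orthogonal to [r]; solving for [f x] shows
    which multiple of [r] represents [f]. *)
Lemma Riesz (f : H -> R[i]) (C : R) :
  (forall a x y, f (a *: x + y) = a * f x + f y) ->
  (forall x, rnorm (f x) <= C * rnorm x) ->
  exists z, forall x, f x = inner x z.
Proof.
move=> flin fbnd.
have [f0|] := pselect (forall x, f x = 0).
  by exists 0 => x; rewrite f0 inner0r.
move=> /existsNP[y fy].
have f0 : f 0 = 0 by have := flin (-1) 0 0; rewrite scaler0 addr0 mulN1r addNr.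
have kersub : subspace [set x | f x = 0].
  by split=> [//|a u v /= fu fv]; rewrite flin fu fv mulr0 addr0.
have kercl : seq_closed [set x | f x = 0].
  move=> u l /= fu ul; apply: rnorm_small0 => e e0.
  (* [C] carries no sign assumption; [D] is positive and dominates it. *)
  pose D := `|C| + 1; have D0 : 0 < D by rewrite ltr_wpDl.
  have [N /(_ _ (leqnn N)) HN] := ul _ (divr_gt0 e0 D0).
  have -> : f l = - f (u N - l).
    by rewrite [u N - l]addrC -(scaleN1r l) flin fu mulN1r addr0 opprK.
  rewrite rnormN (le_trans (fbnd _))// (@le_trans _ _ (D * rnorm (u N - l)))//.
    rewrite ler_wpM2r ?rnorm_ge0// /D; have := ler_norm C; lra.
  by rewrite mulrC -ler_pdivlMr// ltW.
have [s fs sorth] := orthogonal_projection y kersub kercl.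
pose r := y - s.
have fr : f r = f y.
  by rewrite /r addrC -(scaleN1r s) flin fs mulr0 add0r.
have frn0 : f r != 0 by rewrite fr; exact/eqP.
have rr : inner r r != 0.
  by apply: contra_neq frn0 => /inner_eq0 ->.
exists (((f r)^* / inner r r) *: r) => x.
rewrite innerZr rmorphM /= conjCK fmorphV /= -innerC.
have : inner r (f r *: x + (- f x *: r)) = 0.
  by apply: sorth => /=; rewrite flin -[_ *: r]addr0 flin f0 addr0; ring.
rewrite innerDr !innerZr => h.
have : inner (f r *: x + (- f x *: r)) r = 0.
  rewrite innerC innerDr !innerZr h rmorph0 //.
rewrite innerDl !innerZl => /eqP; rewrite mulNr subr_eq0 => /eqP fx.
by rewrite mulrAC fx mulfK.
Qed.

End Completeness.

(** * Resolvents of self-adjoint operators *)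

Section SelfAdjoint.
Variables (R : realType) (H : hilbertType R).
Implicit Types (x y : H) (z w : R[i]).

Section LinearOperator.
Variables (K : hilbertType R) (T : operator H K).
Hypothesis T_lin : linear_operator T.

Lemma dom_subspace : subspace (dom T).
Proof. by split=> [|a x y Tx Ty]; [exact: T_lin.1|exact: (T_lin.2 a x y Tx Ty).1]. Qed.

Lemma opfun_linear a x y : dom T x -> dom T y -> T (a *: x + y) = a *: T x + T y.
Proof. by move=> Tx Ty; exact: (T_lin.2 a x y Tx Ty).2. Qed.

Lemma opfun0 : T 0 = 0.
Proof.
by have := opfun_linear (-1) T_lin.1 T_lin.1; rewrite scaler0 addr0 scaleN1r addNr.
Qed.

Lemma opfunZ a x : dom T x -> T (a *: x) = a *: T x.
Proof. by move=> Tx; have := opfun_linear a Tx T_lin.1; rewrite !addr0 opfun0 addr0. Qed.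

Lemma opfunD x y : dom T x -> dom T y -> T (x + y) = T x + T y.
Proof. by move=> Tx Ty; rewrite -{1}[x]scale1r opfun_linear// scale1r. Qed.

Lemma opfunN x : dom T x -> T (- x) = - T x.
Proof. by move=> Tx; rewrite -scaleN1r opfunZ// scaleN1r. Qed.

End LinearOperator.

Variable A : operator H H.

Lemma bounded_mapP (K : hilbertType R) (f : H -> K) (C : R) :
  (forall x, rnorm (f x) <= C * rnorm x) -> bounded_map f.
Proof.
by move=> fC; exists C => x; rewrite -!rnormE -rmorphM /= lecR.
Qed.

Lemma zsubop_linear z : linear_operator A -> linear_operator (zsubop A z).
Proof.
move=> A_lin; split=> [|a x y Ax Ay]; first exact: A_lin.1.
split; first exact: (dom_subspace A_lin).2.
by rewrite /= opfun_linear// !scalerDr opprD scalerN !scalerA [z * a]mulrC addrACA.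
Qed.

Section Resolvent.
Variable z : R[i].
Hypothesis z_res : resolvent_set A z.

Lemma resolventK x : zsubop A z (resolvent A z x) = x.
Proof.
have [[_ _ Asurj] _] := z_res; apply: pinvK; rewrite inE.
exact: (Asurj x I).
Qed.

Lemma resolvent_dom x : dom A (resolvent A z x).
Proof.
have [[_ _ Asurj] _] := z_res.
by apply: (surjpinv_image_sub Asurj); exists x.
Qed.

Lemma zsubopK x : dom A x -> resolvent A z (zsubop A z x) = x.
Proof.
by have [[_ Ainj _] _] := z_res => Ax; apply: pinvKV => //; rewrite inE.
Qed.

Lemma opfun_resolvent x : A (resolvent A z x) = z *: resolvent A z x - x.
Proof. by rewrite -[X in _ - X]resolventK /= opprD opprK addrCA subrr addr0. Qed.

Lemma resolvent_linear a x y : linear_operator A ->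
  resolvent A z (a *: x + y) = a *: resolvent A z x + resolvent A z y.
Proof.
move=> A_lin; have rdom := resolvent_dom.
rewrite -[RHS]zsubopK; last exact: (dom_subspace A_lin).2.
by rewrite (opfun_linear (zsubop_linear z A_lin) a (rdom x) (rdom y)) !resolventK.
Qed.

Lemma resolvent_bounded : exists C : R, 0 <= C /\
  forall x, rnorm (resolvent A z x) <= C * rnorm x.
Proof.
have [_ [C HC]] := z_res; exists `|C|; split=> // x.
apply: (@le_trans _ _ (C * rnorm x)).
  by have := HC x; rewrite -!rnormE -rmorphM /= lecR.
by rewrite ler_wpM2r ?rnorm_ge0 ?ler_norm.
Qed.

End Resolvent.

(** The lower bound yields injectivity and, read at [resolvent A z y], the boundedness of the
    inverse with the same [C]. *)
Lemma resolvent_setP z (C : R) : linear_operator A ->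
  (forall x, dom A x -> rnorm x <= C * rnorm (zsubop A z x)) ->
  (forall y, exists2 x, dom A x & zsubop A z x = y) ->
  resolvent_set A z.
Proof.
move=> A_lin lb surj.
have Abij : set_bij (dom A) setT (zsubop A z).
  split=> // [x y|y _]; last by have [x Ax <-] := surj y; exists x.
  rewrite !inE => Ax Ay xy.
  apply/eqP; rewrite -subr_eq0; apply/eqP/rnorm0_eq0/eqP.
  have Axy : dom A (x - y).
    by rewrite addrC -scaleN1r; exact: (dom_subspace A_lin).2.
  rewrite eq_le rnorm_ge0 andbT (le_trans (lb _ Axy))//.
  have -> : zsubop A z (x - y) = 0.
    rewrite addrC -scaleN1r (opfun_linear (zsubop_linear z A_lin) _ Ay Ax).
    by rewrite xy scaleN1r addNr.
  by rewrite /rnorm normr0 mulr0.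
split=> //; apply: (@bounded_mapP _ _ C) => y.
have [_ _ Asurj] := Abij.
have rdom : dom A (resolvent A z y).
  by apply: (surjpinv_image_sub Asurj); exists y.
have -> : rnorm y = rnorm (zsubop A z (resolvent A z y)).
  by congr rnorm; apply/esym/pinvK; rewrite inE; exact: Asurj.
exact: lb.
Qed.

(** * Adjoint relations and resolvent set of a self-adjoint operator *)

Hypothesis A_sa : self_adjoint A.

Let A_lin : linear_operator A.
Proof. by case: A_sa. Qed.

Lemma self_adjoint_inner x y : dom A x -> dom A y -> inner (A x) y = inner x (A y).
Proof.
have [_ _ domA eqA] := A_sa => Ax Ay.
have [y' yy'] : dom (adjoint A) y by rewrite domA.
by rewrite -(eqA _ Ay) /=; have := @getPex _ (adjoint_rel A y); apply => //; exists y'.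
Qed.

(** Equality of the domains of [A] and its adjoint puts [y] in [dom A]; density of [dom A] then
    determines the value there. *)
Lemma self_adjoint_rel y y' : adjoint_rel A y y' -> dom A y /\ A y = y'.
Proof.
move=> yy'; have [_ dA domA _] := A_sa.
have Ay : dom A y by rewrite -domA; exists y'.
split=> //; apply/eqP; rewrite -subr_eq0; apply/eqP/(dense_orth dA) => s As.
by rewrite innerBr -self_adjoint_inner// yy'// subrr.
Qed.

Lemma zsubop_inner z x y : dom A x -> dom A y ->
  inner (zsubop A z x) y = inner x (zsubop A z^* y).
Proof.
move=> Ax Ay /=.
by rewrite innerDl innerDr innerNl innerNr innerZl innerZr self_adjoint_inner// conjCK.
Qed.

(** The hypothesis says, in weak form, that [A y = z^* *: y - v], and self-adjointness makes a weak
    solution a genuine one. *)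
Lemma zsubop_adjoint z y v :
  (forall x, dom A x -> inner (zsubop A z x) y = inner x v) ->
  dom A y /\ zsubop A z^* y = v.
Proof.
move=> yv; have [|Ay Ayv] := @self_adjoint_rel y (z^* *: y - v).
  move=> x Ax; rewrite innerBr -yv//= innerDl innerNl innerZl innerZr conjCK.
  by ring.
by split=> //=; rewrite Ayv opprB subrK.
Qed.

(** The conditions on [z] single out ['i] and [- 'i] in a form stable under conjugation. The cross
    terms cancel since [inner (A x) x = inner x (A x)]. *)
Lemma rnorm_zsubop_imaginary z x : z^* = - z -> z * z^* = 1 -> dom A x ->
  rnorm (zsubop A z x) ^+ 2 = rnorm (A x) ^+ 2 + rnorm x ^+ 2.
Proof.
move=> zN z1 Ax; apply: (@complexI R); rewrite rmorphD /= -!inner_rnorm.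
rewrite innerDl !innerDr !innerNl !innerNr !innerZl !innerZr (self_adjoint_inner Ax Ax).
by rewrite [z * (z^* * _)]mulrA z1 zN; ring.
Qed.

(* The range of -A + z is closed since -A + z is expanding and A is closed, and
   its orthogonal complement is the kernel of -A + z^*, which is trivial. *)
Lemma imaginary_resolvent_set z : z^* = - z -> z * z^* = 1 -> resolvent_set A z.
Proof.
have expand w x : w^* = - w -> w * w^* = 1 -> dom A x ->
    rnorm x <= rnorm (zsubop A w x).
  move=> wN w1 Ax; rewrite -(@ler_pXn2r _ 2) ?nnegrE ?rnorm_ge0//.
  by rewrite rnorm_zsubop_imaginary// lerDr sqr_ge0.
move=> zN z1; have Az_lin := zsubop_linear z A_lin.
apply: (@resolvent_setP z 1) => // [x Ax|y]; first by rewrite mul1r expand.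
pose S := [set zsubop A z x | x in dom A].
have Ssub : subspace S.
  split=> [|a _ _ [u Au <-] [v Av <-]].
    by exists 0; [exact: A_lin.1|exact: (opfun0 Az_lin)].
  exists (a *: u + v); first exact: (dom_subspace A_lin).2.
  exact: (opfun_linear Az_lin).
have Scl : seq_closed S.
  move=> u l Su ul.
  have /choice[x Hx] n : exists x, dom A x /\ zsubop A z x = u n.
    by have [x Ax <-] := Su n; exists x.
  have [|k xk] := @rnorm_complete _ _ x.
    move=> e e0; have [N HN] := rnorm_cvg_cauchy ul e0; exists N => n m Nn Nm.
    apply: le_lt_trans (HN _ _ Nn Nm).
    have [Axn <-] := Hx n; have [Axm <-] := Hx m.
    have Anm : dom A (x n - x m).
      by rewrite addrC -scaleN1r; exact: (dom_subspace A_lin).2.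
    rewrite (le_trans (expand _ _ zN z1 Anm))//.
    rewrite addrC -scaleN1r (opfun_linear Az_lin _ Axm Axn).
    by rewrite scaleN1r addrC.
  (* Testing against [w] in [dom A] moves [A] off [x n], so the limit can be taken without knowing
     that [A (x n)] converges to [A k]. *)
  have [|Ak kl] := @self_adjoint_rel k (z *: k - l).
    move=> w Aw.
    have := inner_cvgl (x := A w - z^* *: w) (y := - w) xk ul.
    have Hn n : inner (A w - z^* *: w) (x n) = inner (- w) (u n).
      have [Axn <-] := Hx n; rewrite innerBl self_adjoint_inner//= innerDr innerNr.
      by rewrite !innerNl innerZl innerZr; ring.
    move=> /(_ Hn); rewrite innerBl innerBr innerZl innerZr innerNl => /eqP.
    by rewrite subr_eq addrC => /eqP.
  by exists k => //=; rewrite kl opprB subrK.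
have [s [x Ax <-] orth] := orthogonal_projection y Ssub Scl.
exists x => //; apply/eqP; rewrite -subr_eq0 -oppr_eq0 opprB; apply/eqP.
have [|Ar r0] := @zsubop_adjoint z (y - zsubop A z x) 0.
  move=> w Aw; rewrite inner0r innerC orth ?rmorph0//; by exists w.
apply/rnorm0_eq0/eqP; rewrite eq_le rnorm_ge0 andbT.
have zN' : z^*^* = - z^* by rewrite conjCK zN opprK.
have z1' : z^* * z^*^* = 1 by rewrite conjCK mulrC.
by rewrite (le_trans (expand _ _ zN' z1' Ar))// r0 /rnorm normr0.
Qed.

(** Pairing [resolvent A z w] with [zsubop A z^* w] gives [inner w w], whence the lower bound. A
    preimage of [y] is the Riesz vector of [x] sent to [inner (resolvent A z x) y]. *)
Lemma conj_resolvent_set z : resolvent_set A z -> resolvent_set A z^*.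
Proof.
move=> z_res; have rdom := resolvent_dom z_res.
have [C [C0 HC]] := resolvent_bounded z_res.
apply: (@resolvent_setP _ C) => // [w Aw|y].
  have [w0|wn0] := eqVneq (rnorm w) 0; first by rewrite w0 mulr_ge0 ?rnorm_ge0.
  have w_gt0 : 0 < rnorm w by rewrite lt_neqAle eq_sym wn0 rnorm_ge0.
  rewrite -(ler_pM2r w_gt0) -expr2.
  have -> : rnorm w ^+ 2 = rnorm (inner (resolvent A z w) (zsubop A z^* w)).
    rewrite -zsubop_inner// resolventK// inner_rnorm /rnorm ger0_norm//.
    by rewrite lecR sqr_ge0.
  apply: (le_trans (CauchySchwarz_rnorm _ _)).
  by rewrite mulrAC ler_wpM2r ?rnorm_ge0.
have [||v Hv] := @Riesz _ _ (fun x => inner (resolvent A z x) y) (C * rnorm y).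
- by move=> a u v; rewrite resolvent_linear// innerDl innerZl.
- move=> x; apply: (le_trans (CauchySchwarz_rnorm _ _)).
  by rewrite mulrAC ler_wpM2r ?rnorm_ge0.
have [|Av Avy] := @zsubop_adjoint z v y; last by exists v.
by move=> x Ax; rewrite -Hv zsubopK.
Qed.

Lemma resolvent_inner z x y : resolvent_set A z ->
  inner (resolvent A z^* x) y = inner x (resolvent A z y).
Proof.
move=> z_res; have z_res' := conj_resolvent_set z_res.
rewrite -{1}(resolventK z_res y) -[in RHS](resolventK z_res' x) zsubop_inner ?conjCK//.
all: exact: resolvent_dom.
Qed.

End SelfAdjoint.

(** * The operators G(z) and the singular perturbation *)

Section Singular.
Variables (R : realType) (H h : hilbertType R).
Variables (A : operator H H) (tau : operator H h) (Theta : operator h h).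
Hypothesis A_sa : self_adjoint A.
Hypothesis tau_surj : bounded_linear_surjection A tau.
Hypothesis ker_dense : dense (ker tau).
Implicit Types (x : H) (xi : h) (z w : R[i]).

Let A_lin : linear_operator A.
Proof. by case: A_sa. Qed.

Let tau_lin : linear_operator tau.
Proof. by case: tau_surj. Qed.

Let dom_tau x : dom tau x = dom A x.
Proof. by case: tau_surj => ->. Qed.

Let i_res : resolvent_set A 'i.
Proof. by apply: imaginary_resolvent_set; rewrite // conjCi// mulrN -expr2 sqrCi opprK. Qed.

Let Ni_res : resolvent_set A (- 'i).
Proof. by rewrite -conjCi; exact: conj_resolvent_set. Qed.

(** * Boundedness of [tau] after the resolvent, and the operators [Gz] *)

Lemma norm_plus_le x : norm_plus A x <= (rnorm (A x) + rnorm x)%:C%C.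
Proof.
have s0 : 0 <= rnorm (A x) + rnorm x by rewrite addr_ge0 ?rnorm_ge0.
rewrite /norm_plus /inner_plus !inner_rnorm -rmorphD /=.
rewrite -[leRHS]sqrCK ?lecR// ler_sqrtC ?nnegrE ?lecR ?addr_ge0 ?sqr_ge0//.
  rewrite -rmorphXn /= lecR sqrrD lerD2r lerDl.
  by rewrite mulrn_wge0// mulr_ge0 ?rnorm_ge0.
by rewrite exprn_ge0// lecR.
Qed.

(** Since [A] applied to the resolvent of [x] is [z *: resolvent A z x - x], the resolvent is
    bounded also for the graph norm, for which [tau] is bounded. *)
Lemma tau_resolvent_bounded z : resolvent_set A z ->
  exists C : R, forall x, rnorm (tau (resolvent A z x)) <= C * rnorm x.
Proof.
move=> z_res; have [D [D0 HD]] := resolvent_bounded z_res.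
have [_ _ [C HC] _] := tau_surj.
exists (`|C| * (rnorm z * D + 1 + D)) => x; set y := resolvent A z x.
have tauy : rnorm (tau y) <= `|C| * (rnorm (A y) + rnorm y).
  rewrite -lecR rnormE (le_trans (HC _ (resolvent_dom z_res x)))//.
  apply: (@le_trans _ _ (`|C|%:C%C * norm_plus A y)).
    rewrite ler_wpM2r ?lecR ?ler_norm// /norm_plus sqrtC_ge0 /inner_plus.
    by rewrite !inner_rnorm -rmorphD /= lecR addr_ge0 ?sqr_ge0.
  by rewrite rmorphM /= ler_wpM2l ?norm_plus_le// lecR.
apply: (le_trans tauy); rewrite -mulrA ler_wpM2l//.
have Ay : rnorm (A y) <= rnorm z * rnorm y + rnorm x.
  by rewrite opfun_resolvent// (le_trans (ler_rnormD _ _))// rnormN rnormZ.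
have yD : rnorm y <= D * rnorm x := HD x.
have : rnorm z * rnorm y <= rnorm z * (D * rnorm x) by rewrite ler_wpM2l ?rnorm_ge0.
lra.
Qed.

(** By Riesz the adjoint relation has a solution for every [xi], so the vector picked by [get] in
    [Gz] does satisfy it. *)
Lemma inner_Gz z x xi : resolvent_set A z ->
  inner (tau (resolvent A z^* x)) xi = inner x (Gz A tau z xi).
Proof.
move=> z_res; have z_res' := conj_resolvent_set A_sa z_res.
have [C HC] := tau_resolvent_bounded z_res'.
have rdom y : dom tau (resolvent A z^* y) by rewrite dom_tau; exact: resolvent_dom.
have [||g Hg] := @Riesz _ _ (fun x => inner (tau (resolvent A z^* x)) xi) (C * rnorm xi).
- move=> a u v; rewrite resolvent_linear// (opfun_linear tau_lin)//.
  by rewrite innerDl innerZl.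
- move=> u; apply: (le_trans (CauchySchwarz_rnorm _ _)).
  by rewrite mulrAC ler_wpM2r ?rnorm_ge0.
pose F := everywhere (tau \o resolvent A z^*).
suff : adjoint_rel F xi (Gz A tau z xi) by apply.
by apply: (@getPex _ (adjoint_rel F xi)); exists g => u _; exact: Hg.
Qed.

Lemma GzB z xi eta : resolvent_set A z ->
  Gz A tau z (xi - eta) = Gz A tau z xi - Gz A tau z eta.
Proof. by move=> z_res; apply: eq_inner => x; rewrite innerBr -!inner_Gz// innerBr. Qed.

(** As [tau] is onto and the resolvent at [z^*] has range [dom A], their composite is onto, so its
    adjoint is injective. *)
Lemma Gz_inj z : resolvent_set A z -> injective (Gz A tau z).
Proof.
move=> z_res xi eta Gxe; apply: eq_inner => k.
have [_ _ _ /(_ k I)[d Ad <-]] := tau_surj.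
rewrite -(zsubopK (conj_resolvent_set A_sa z_res) Ad).
by rewrite !inner_Gz// Gxe.
Qed.

(** Adjoint form of the first resolvent identity, composed with [tau]. *)
Lemma resolvent_Gz z w xi : resolvent_set A z -> resolvent_set A w ->
  Gz A tau z xi - Gz A tau w xi = (w - z) *: resolvent A w (Gz A tau z xi).
Proof.
move=> z_res w_res; apply: eq_inner => x.
have z_res' := conj_resolvent_set A_sa z_res.
have w_res' := conj_resolvent_set A_sa w_res.
set u := resolvent A w^* x; have Au : dom A u by exact: resolvent_dom.
have rdom y : dom tau (resolvent A z^* y) by rewrite dom_tau; exact: resolvent_dom.
(* The resolvent identity at the conjugate points, applied to [x]. *)
have uE : u = (z^* - w^*) *: resolvent A z^* u + resolvent A z^* x.
  have Au_w : A u = w^* *: u - x := opfun_resolvent w_res' x.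
  rewrite -resolvent_linear// -[LHS](zsubopK z_res' Au) /= Au_w; congr (resolvent A _ _).
  by rewrite opprB scalerBl [LHS]addrC addrCA [LHS]addrC.
rewrite innerBr innerZr -resolvent_inner// -/u -!inner_Gz// -/u.
rewrite [in X in _ - X]uE (opfun_linear tau_lin)// innerDl innerZl rmorphB /=.
ring.
Qed.

(** For [s] in the kernel of [tau], moving [-A + z] across the inner product with [g] gives
    [inner (tau s) xi = 0]. Density of the kernel then yields [zsubop A z g = 0], so [g] and [xi]
    vanish. *)
Lemma Gz_dom0 z xi : resolvent_set A z -> dom A (Gz A tau z xi) -> xi = 0.
Proof.
move=> z_res; set g := Gz A tau z xi => Ag.
have g0 : zsubop A z g = 0.
  apply: (dense_orth ker_dense) => s [s_dom s0].
  have As : dom A s by rewrite -dom_tau.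
  rewrite -[z]conjCK -zsubop_inner// -inner_Gz//.
  by rewrite zsubopK ?s0 ?inner0l//; exact: conj_resolvent_set.
have g00 : g = 0.
  have A0 : dom A 0 by exact: A_lin.1.
  rewrite -(zsubopK z_res Ag) g0 -[in LHS](opfun0 (zsubop_linear z A_lin)).
  exact: zsubopK.
by apply: (Gz_inj z_res); rewrite -/g g00 -[in RHS](subrr xi) GzB// subrr.
Qed.

(** * The operator [Gstar] and the unique decomposition of vectors in the domain of [Ahat] *)

Let RG xi := resolvent A 'i (Gz A tau (- 'i) xi).

Lemma Gz_i xi : Gz A tau 'i xi = Gz A tau (- 'i) xi - (2 * 'i) *: RG xi.
Proof.
rewrite (_ : 2 * 'i = 'i - - 'i); last by rewrite opprK mulr_natl mulr2n.
by rewrite -resolvent_Gz// subKr.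
Qed.

Lemma GstarE xi : Gstar A tau xi = Gz A tau (- 'i) xi - 'i *: RG xi.
Proof.
apply: eq_innerl => y; rewrite /Gstar Gz_i innerZl innerDl !innerBl !innerZl.
by field.
Qed.

Lemma Gstar_sub_Gz z xi : resolvent_set A z ->
  dom A (Gstar A tau xi - Gz A tau z xi) /\
  zsubop A z (Gstar A tau xi - Gz A tau z xi) = z *: Gstar A tau xi - RG xi.
Proof.
move=> z_res; have rdom := resolvent_dom z_res.
have Az_lin := zsubop_linear z A_lin.
(* Average of the identities [resolvent_Gz] from ['i] to [z] and from [- 'i] to [z]; each difference
   is visibly in [dom A]. *)
have -> : Gstar A tau xi - Gz A tau z xi =
    (2^-1 * (z - 'i)) *: resolvent A z (Gz A tau 'i xi) +
    (2^-1 * (z + 'i)) *: resolvent A z (Gz A tau (- 'i) xi).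
  have := resolvent_Gz xi Ni_res z_res; rewrite opprK => Ni.
  rewrite -!scalerA -Ni -resolvent_Gz// /Gstar.
  by apply: eq_innerl => y; rewrite !(innerBl, innerDl, innerZl); field.
split; first by apply: subspaceD; [|apply: subspaceZ..]; do ?exact: (dom_subspace A_lin).
rewrite (opfun_linear Az_lin _ (rdom _)); last exact: (subspaceZ _ (dom_subspace A_lin)).
rewrite (opfunZ Az_lin _ (rdom _)) !resolventK// GstarE Gz_i.
apply: eq_innerl => y; rewrite !(innerBl, innerDl, innerZl).
set g := inner _ y; set r := inner _ y.
(* The square of ['i] is isolated first, since [field] treats ['i] as an indeterminate. *)
transitivity (z * (g - 'i * r) + ('i * 'i) * r); first by field.
by rewrite -expr2 sqrCi mulN1r.
Qed.

(** [Gstar] and [Gz] at ['i] differ by a vector of [dom A], which reduces the claim to [Gz_dom0]. *)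
Lemma Gstar_dom0 xi : dom A (Gstar A tau xi) -> xi = 0.
Proof.
move=> AG; apply: (Gz_dom0 i_res).
have [AD _] := Gstar_sub_Gz xi i_res.
rewrite (_ : Gz _ _ _ _ = -1 *: (Gstar A tau xi - Gz A tau 'i xi) + Gstar A tau xi).
  exact: (dom_subspace A_lin).2.
by rewrite scaleN1r opprB subrK.
Qed.

Lemma GstarB xi eta : Gstar A tau (xi - eta) = Gstar A tau xi - Gstar A tau eta.
Proof. by rewrite /Gstar !GzB// -scalerBr opprD addrACA. Qed.

(** The difference of two decompositions puts a value of [Gstar] in [dom A]. Uniqueness lets any
    known decomposition replace the one picked by [get] in [Ahat]. *)
Lemma Ahat_decomposition_uniq phi p q :
  Ahat_decomposition A tau Theta phi p -> Ahat_decomposition A tau Theta phi q -> p = q.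
Proof.
case: p q => [p xi] [q eta] [/= -> Ap _ _] [/= pq Aq _ _].
have pqE : Gstar A tau (eta - xi) = p - q.
  rewrite GstarB; apply/eqP; rewrite subr_eq addrAC pq addrAC subrr add0r //.
have /eqP : eta - xi = 0.
  apply: Gstar_dom0; rewrite pqE addrC -scaleN1r.
  exact: (dom_subspace A_lin).2.
by rewrite subr_eq0 => /eqP ee; move: pq; rewrite ee => /addIr ->.
Qed.

Lemma zsubop_Ahat z phi p xi : resolvent_set A z ->
  Ahat_decomposition A tau Theta phi (p, xi) ->
  dom A (phi - Gz A tau z xi) /\
  zsubop (Ahat A tau Theta) z phi = zsubop A z (phi - Gz A tau z xi).
Proof.
move=> z_res dec; have [AD AzD] := Gstar_sub_Gz xi z_res.
have [/= phiE Ap _ _] := dec.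
have -> : phi - Gz A tau z xi = p + (Gstar A tau xi - Gz A tau z xi).
  by rewrite phiE addrA.
split; first exact: subspaceD (dom_subspace A_lin) Ap AD.
transitivity (zsubop A z p + (z *: Gstar A tau xi - RG xi)); last first.
  by rewrite -AzD; exact/esym/(opfunD (zsubop_linear z A_lin) Ap AD).
have -> : get (Ahat_decomposition A tau Theta phi) = (p, xi).
  exact: Ahat_decomposition_uniq (getI dec) dec.
rewrite /= -/(RG xi) phiE scalerDr opprD addrACA; congr (_ + _).
by rewrite addrC.
Qed.

End Singular.

Theorem theorem3p4 (R : realType) (H h : hilbertType R)
    (A : operator H H) (tau : operator H h) (Theta : operator h h)
    (A_sa : self_adjoint A)
    (tau_surj : bounded_linear_surjection A tau)
    (ker_dense : dense (ker tau))
    (Theta_sa : self_adjoint Theta)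
    (lambda : R[i])
    (lambda_eig : point_spectrum (Ahat A tau Theta) lambda)
    (lambda_res : resolvent_set A lambda) :
  set_bij (ker (addop Theta (Gamma A tau lambda)))
          (ker (zsubop (Ahat A tau Theta) lambda))
          (Gz A tau lambda).
Proof.
have [A_lin _ _ _] := A_sa; have [domE tau_lin _ _] := tau_surj.
split.
- move=> xi [/= Txi T0]; set phi := Gz A tau lambda xi.
  have [AD _] := Gstar_sub_Gz A_sa tau_surj xi lambda_res.
  (* The regular part is minus the argument of [tau] in [Gamma], so the boundary condition is
     exactly the kernel equation for [xi]. *)
  have dec : Ahat_decomposition A tau Theta phi (phi - Gstar A tau xi, xi).
    split=> //=; first by rewrite subrK.
      by rewrite -opprB -scaleN1r; apply: subspaceZ => //; exact: dom_subspace.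
    rewrite -opprB (opfunN tau_lin) ?domE//.
    by apply/eqP; rewrite -addr_eq0; apply/eqP.
  split; first by exists (phi - Gstar A tau xi, xi).
  have [_ ->] := zsubop_Ahat A_sa tau_surj ker_dense lambda_res dec.
  by rewrite subrr (opfun0 (zsubop_linear lambda A_lin)).
- by move=> xi eta _ _; exact: (Gz_inj A_sa tau_surj lambda_res).
- move=> phi [[[p xi] dec] Ap0].
  have [AD AzD] := zsubop_Ahat A_sa tau_surj ker_dense lambda_res dec.
  (* The difference lies in [dom A] and is annihilated by [-A + lambda], which is injective
     there. *)
  have phiE : phi = Gz A tau lambda xi.
    apply/eqP; rewrite -subr_eq0; apply/eqP.
    rewrite -(zsubopK lambda_res AD) -AzD Ap0.
    rewrite -[in LHS](opfun0 (zsubop_linear lambda A_lin)).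
    by rewrite zsubopK//; exact: A_lin.1.
  (* Equating the two expressions of [phi] gives [p] as minus the argument of [tau] in [Gamma]; the
     boundary condition becomes the kernel equation. *)
  exists xi => //; have [/= phiE' Ap Txi TE] := dec.
  split=> //=; rewrite TE /Gamma -phiE [in X in _ + X]phiE' opprD addrCA subrr addr0.
  by rewrite (opfunN tau_lin) ?domE// subrr.
Qed.
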